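(* Let $G$ be a unicyclic graph with $n \ge 4$ vertices and maximum degree $\Delta\ge 3$, let $q=\lfloor \frac{n}{\Delta-1}\rfloor$, and let $a$ be a real number with $a>1$ or $0<a\le e^{-2}$. If $q=1$ or $n=2\Delta-2$, then $$ SEI_a(G) \le \Delta\, a^\Delta + (n-\Delta+1)\,a^{n-\Delta+1} + 2a^2 + (n-3)\,a. $$ If $q>1$ and $n\ne 2\Delta-2$, then $$ SEI_a(G) \le q\,\Delta\, a^\Delta + \big(n-q(\Delta-1)+1\big)\,a^{n-q(\Delta-1)+1} + (n-q-1)\,a. $$ Moreover, in each case the upper bound is attained if and only if $G\in\mathcal{K}_n^\Delta$.
   Context: All graphs are finite, connected, simple (no loops, no multiple edges) and have at least one edge. A unicyclic graph is a graph containing exactly one cycle. For a vertex $u$ of $G$, $d_u$ denotes its degree. For a positive real number $a\ne 1$, the variable sum exdeg index is $SEI_a(G)=\sum_{uv\in E(G)}(a^{d_u}+a^{d_v})=\sum_{u\in V(G)} d_u a^{d_u}$. For $n\ge 4$, $3\le\Delta\le n-1$ and $q=\lfloor \frac{n}{\Delta-1}\rfloor$, define the $n$-tuple $\mathbf{z}$ as follows. If $q=1$ or $n=2\Delta-2$, then $\mathbf{z}=(\Delta,\,n-\Delta+1,\,2,\,1,\dots,1)$ with $n-3$ entries equal to $1$ at the end. If $q\ge 2$ and $n\ne 2\Delta-2$, then $\mathbf{z}=(z_1,\dots,z_n)$ with $z_j=\Delta$ for $1\le j\le q$, $z_{q+1}=n-q(\Delta-1)+1$, and $z_j=1$ for $q+1<j\le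 n$. $\mathcal{K}_n^\Delta$ is the set of unicyclic graphs with $n$ vertices whose degree sequence (in non-increasing order) is $\mathbf{z}$. *)

(* Defs.v *)
From HB Require Import structures.
From mathcomp Require Import all_boot all_order all_algebra.
From mathcomp Require Import reals.

Set Implicit Arguments.
Unset Strict Implicit.
Unset Printing Implicit Defensive.

Import Order.TTheory GRing.Theory Num.Theory.

Record simple_graph := SimpleGraph {
  vertex :> finType;
  adj : rel vertex;
  adj_sym : symmetric adj;
  adj_irr : irreflexive adj
}.

Definition edges (G : simple_graph) : {set {set G}} :=
  [set [set u; v] | u in G, v in G & adj u v].

Definition deg (G : simple_graph) (u : G) : nat := #|[set v | adj u v]|.

Definition max_degree (G : simple_graph) : nat := \max_(u : G) deg u.

Definition degree_seq (G : simple_graph) : seq nat :=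
  sort geq [seq deg u | u : G].

Definition connected (G : simple_graph) : Prop :=
  forall u v : G, connect (@adj G) u v.

(* A cycle is identified with its edge set, so that the vertex sequences which
   differ only by their starting point or direction give the same cycle. *)
Definition is_cycle (G : simple_graph) (C : {set {set G}}) : Prop :=
  exists c : seq G,
    [/\ ucycle (@adj G) c, 2 < size c & C = [set [set u; next c u] | u in c]].

(* Connectedness is included because all graphs are assumed connected. *)
Definition unicyclic (G : simple_graph) : Prop :=
  connected G /\ exists! C : {set {set G}}, is_cycle C.

(* The inner sum over the two endpoints of the edge f = {u, v} is
   a^(d_u) + a^(d_v). *)
Definition SEI (R : realType) (a : R) (G : simple_graph) : R :=
  (\sum_(f in edges G) \sum_(u in f) a ^+ deg u)%R.

(* Only meaningful for n >= 4 and 3 <= D <= n - 1: then no subtraction is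
   truncated and the sequence has length n. *)
Definition zseq (n D : nat) : seq nat :=
  let q := n %/ (D - 1) in
  if (q == 1) || (n == 2 * D - 2) then
    [:: D, n - D + 1, 2 & nseq (n - 3) 1]
  else
    nseq q D ++ (n - q * (D - 1) + 1) :: nseq (n - q - 1) 1.

(* The class K_n^D of the unicyclic graphs on n vertices with degree
   sequence zseq n D. *)
Definition in_K (n D : nat) (G : simple_graph) : Prop :=
  [/\ unicyclic G, #|G| = n & degree_seq G = zseq n D].

(* Main.v *)
(* Counting edge ends gives SEI_a(G) = sum_u f(d_u) with f(x) = x a^x, and f is
   strictly convex on the positive integers for a > 1 and for 0 < a < 1/3,
   hence for 0 < a <= e^-2.  A unicyclic graph has as many edges as vertices, so
   the numbers d_u - 1 are nonnegative, at most D - 1, and have sum n; moreover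
   at least three of them are positive, because of the cycle.  By convexity the
   sum is largest exactly when as many of these numbers as possible equal D - 1
   and the rest is carried by a single one.  This violates the
   three-positive-values condition exactly if q = 1 or n = 2D - 2, where
   instead the best choice is D - 1, n - D and 1. *)

Require Import Defs.
From HB Require Import structures.
From mathcomp Require Import all_boot all_order all_algebra.
From mathcomp Require Import reals sequences exp.
From mathcomp Require Import zify ring lra.

Set Implicit Arguments.
Unset Strict Implicit.
Unset Printing Implicit Defensive.

Import Order.TTheory GRing.Theory Num.Theory.

(** * Cycles and edge counts in finite graphs *)

Lemma ucycle_of_min_deg2 (T : finType) (e : rel T) (S : {set T}) :
  symmetric e -> irreflexive e -> S != set0 ->
  (forall u, u \in S -> 1 < #|[set v in S | e u v]|) ->
  exists2 c : seq T, ucycle e c & 2 < size c.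
Proof.
move=> e_sym e_irr /set0Pn[x0 x0S] deg2.
(* A longest simple path in [S] is taken; by maximality, every neighbour in [S] of its first vertex
   lies on it. *)
pose P k := [exists t : k.-tuple T,
  [&& sorted e t, uniq t, all (mem S) t & 0 < k]].
have P1 : exists k, P k.
  by exists 1; apply/existsP; exists [tuple x0]; rewrite /= x0S.
have Pmax k : P k -> k <= #|T|.
  case/existsP=> t /and4P[_ t_uniq _ _].
  by rewrite -(size_tuple t) -(card_uniqP t_uniq) max_card.
case: (ex_maxnP P1 Pmax) => k /existsP[[[|x s] /= /eqP size_s]].
  by rewrite -size_s.
case/and4P=> xs_path /andP[x_s s_uniq] /andP[xS s_S] _ k_max.
have nbr_s v : v \in S -> e x v -> v \in s.
  move=> vS exv; apply: contraTT isT => v_s.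
  have vs_size : size [:: v, x & s] == k.+1 by rewrite /= size_s.
  suff /k_max : P k.+1 by rewrite ltnn.
  apply/existsP; exists (Tuple vs_size).
  rewrite /= e_sym exv xs_path x_s s_uniq vS xS s_S
    !andbT inE negb_or v_s andbT.
  by apply: contraTneq exv => ->; rewrite e_irr.
(* [head x s] is the second vertex of the path. Another neighbour [y] of [x] lies further along, so
   the edge from [y] back to [x] closes a cycle of length at least 3. *)
have [y] : exists y, y \in [set v in S | e x v] :\ head x s.
  apply/set0Pn; rewrite -card_gt0.
  by have := deg2 x xS; rewrite (cardsD1 (head x s)); lia.
rewrite !inE => /and3P[y_head yS exy].
have y_s := nbr_s y yS exy.
case/splitPr: y_s y_head x_s xs_path s_uniq {s_S size_s nbr_s} => s1 s2.
case: s1 => [|z s1] /=; first by rewrite eqxx.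
move=> _ x_s /andP[exz]; rewrite cat_path /= => /and3P[zs1 s1y _].
move=> zs_uniq.
exists [:: x, z & rcons s1 y]; last by rewrite /= size_rcons.
rewrite /ucycle /= exz !rcons_path zs1 s1y last_rcons e_sym exy /=.
have sub : subseq (rcons s1 y) (s1 ++ y :: s2).
  by rewrite -cats1; apply: cat_subseq => //; rewrite /= eqxx sub0seq.
have sub2 : subseq (z :: rcons s1 y) (z :: s1 ++ y :: s2) by rewrite /= eqxx.
have zy_uniq := subseq_uniq sub2 zs_uniq.
rewrite -[(z \notin _) && _]/(uniq (z :: rcons s1 y)) zy_uniq andbT.
by apply: contra x_s; apply: (mem_subseq sub2).
Qed.

(** For symmetric irreflexive [e] this is twice the number of edges induced on [S]. *)
Definition inner_deg_sum (T : finType) (e : rel T) (S : {set T}) : nat :=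
  \sum_(u in S) #|[set v in S | e u v]|.

Lemma inner_deg_sumU1 (T : finType) (e : rel T) (S : {set T}) x :
  symmetric e -> irreflexive e -> x \notin S ->
  inner_deg_sum e (x |: S) = inner_deg_sum e S + #|[set v in S | e x v]|.*2.
Proof.
move=> e_sym e_irr xS; rewrite /inner_deg_sum big_setU1 //=.
have -> : [set v in x |: S | e x v] = [set v in S | e x v].
  by apply/setP=> v; rewrite !inE; case: eqP => // ->; rewrite e_irr !andbF.
have step u : u \in S ->
    #|[set v in x |: S | e u v]| = e x u + #|[set v in S | e u v]|.
  move=> uS; rewrite (cardsD1 x) !inE eqxx /= e_sym; congr (_ + _).
  apply: eq_card => v; rewrite !inE; case: eqP => //= ->.
  by rewrite (negbTE xS).
rewrite (eq_bigr _ step) big_split /=.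
suff -> : \sum_(u in S) e x u = #|[set v in S | e x v]| by lia.
rewrite -sum1_card [RHS](eq_bigl (fun v => (v \in S) && e x v)) => [|v].
  by rewrite [RHS]big_mkcondr; apply: eq_bigr => v _; case: (e x v).
by rewrite inE.
Qed.

(** Deleting a vertex with at most one neighbour in [S] lowers [#|S|.*2] by 2 and the inner sum by
    at most 2, so the bound survives until all inner degrees are at least 2. The slack [.+1] is what
    a degree sum above [#|G|.*2] leaves after the loss of one edge. *)
Lemma ucycle_of_inner_deg_sum (T : finType) (e : rel T) (S : {set T}) :
  symmetric e -> irreflexive e -> S != set0 ->
  #|S|.*2 <= (inner_deg_sum e S).+1 ->
  exists2 c : seq T, ucycle e c & 2 < size c.
Proof.
move=> e_sym e_irr; move: {2}#|S| (leqnn #|S|) => k.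
elim: k S => [|k IHk] S; first by rewrite leqn0 cards_eq0 => ->.
move=> S_le S0 S_sum.
have [/forallP deg2 | ] :=
    boolP [forall u, (u \in S) ==> (1 < #|[set v in S | e u v]|)].
  by apply: (@ucycle_of_min_deg2 _ e S) => // u uS; apply: implyP (deg2 u) uS.
rewrite negb_forall => /existsP[u]; rewrite negb_imply => /andP[uS].
rewrite -leqNgt; set S' := S :\ u.
have uS' : u \notin S' by rewrite !inE eqxx.
have -> : [set v in S | e u v] = [set v in S' | e u v].
  by apply/setP=> v; rewrite !inE; case: eqP => // ->; rewrite e_irr !andbF.
move=> deg1; move: S_sum.
rewrite -(setD1K uS) -/S' inner_deg_sumU1 // cardsU1 uS' add1n => S_sum.
have sz : #|S| = #|S'|.+1 by rewrite (cardsD1 u) uS.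
apply: (IHk S').
- by rewrite -ltnS -sz.
(* If [S'] were empty, the bound would read 2 <= 1. *)
- apply: contraTneq S_sum => S'0; rewrite /inner_deg_sum S'0 big_set0 cards0.
  rewrite (_ : [set v in _ | _] = set0) ?cards0 //.
  by apply/setP=> v; rewrite !inE.
- move: S_sum deg1; move: #|[set v in S' | e u v]| (inner_deg_sum _ _) #|S'|.
  lia.
Qed.

(** By connectedness an edge leaves any nonempty [S] other than the whole of [T]. Adding its outer
    end raises [#|S|.*2] by 2 and the inner sum by at least 2. *)
Lemma inner_deg_sum_grow (T : finType) (e : rel T) (S : {set T}) :
  symmetric e -> irreflexive e -> (forall u v, connect e u v) -> S != set0 ->
  #|S|.*2 <= inner_deg_sum e S -> #|T|.*2 <= inner_deg_sum e [set: T].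
Proof.
move=> e_sym e_irr e_conn; move: {2}#|~: S| (leqnn #|~: S|) => k.
elim: k S => [|k IHk] S.
  by rewrite leqn0 cards_eq0 => /eqP SC0; rewrite -(setCK S) SC0 setC0 cardsT.
move=> S_le S0 S_sum.
have [S_T | S_neqT] := eqVneq S [set: T].
  by move: S_sum; rewrite S_T cardsT.
have [x xS [y yS exy]] : exists2 x, x \in S & exists2 y, y \notin S & e x y.
  case/set0Pn: S0 => x0 x0S.
  have /subsetPn[y0 _ y0S] : ~~ ([set: T] \subset S) by rewrite subTset.
  have [//|noedge] := boolP [exists x in S, exists y in ~: S, e x y].
    case/existsP=> x /andP[xS /existsP[y]]; rewrite inE => /andP[yS exy].
    by exists x => //; exists y.
  have cl : closed e (mem S).
    apply: intro_closed => [|x y exy xS]; first exact: sym_connect_sym.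
    apply: contraNT noedge => yS; apply/existsP; exists x; rewrite xS /=.
    by apply/existsP; exists y; rewrite inE yS.
  by move: y0S; rewrite -(closed_connect cl (e_conn x0 y0)) x0S.
apply: (IHk (y |: S)).
- rewrite -ltnS (leq_trans _ S_le) //; apply: proper_card.
  rewrite setCU; apply/properP; split; first exact: subsetIr.
  by exists y; rewrite !inE // eqxx.
- by apply/set0Pn; exists y; rewrite setU11.
- rewrite inner_deg_sumU1 // cardsU1 yS.
  have : 0 < #|[set v in S | e y v]|.
    by apply/card_gt0P; exists x; rewrite inE xS e_sym.
  by move: S_sum; move: #|[set v in S | e y v]| (inner_deg_sum _ _) #|S|; lia.
Qed.

(** After a rotation that puts [x] first, its successor is the second entry and its predecessor the
    last one; these are different positions in a list longer than 2. *)
Lemma next_neq_prev (T : eqType) (c : seq T) x :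
  uniq c -> 2 < size c -> x \in c -> next c x != prev c x.
Proof.
move=> c_uniq c_size /rot_to[i s rot_c].
rewrite -(next_rot i c_uniq) -(prev_rot i c_uniq) rot_c.
have : uniq (x :: s) by rewrite -rot_c rot_uniq.
have : 2 < size (x :: s) by rewrite -rot_c size_rot.
case/lastP: s {rot_c} => [|s z] //; case: s => [|y s] //= _.
rewrite !inE mem_rcons inE !negb_or eqxx => /and3P[/and3P[xy xz xs] + _].
rewrite mem_rcons inE negb_or => /andP[yz _].
rewrite (negbTE xy).
have -> : prev_at x x y (rcons s z) = z.
  elim: s y {xy yz} xs => [|w s IHs] y /=.
    by rewrite (negbTE xz) eqxx.
  rewrite inE negb_or => /andP[xw xs].
  by rewrite (negbTE xw); apply: IHs.
by move: yz; rewrite eq_sym.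
Qed.

Lemma cycle_deg_gt1 (T : finType) (e : rel T) (c : seq T) u :
  symmetric e -> ucycle e c -> 2 < size c -> u \in c ->
  1 < #|[set v in c | e u v]|.
Proof.
move=> e_sym /andP[c_cycle c_uniq] c_size uc.
apply/card_gt1P; exists (next c u), (prev c u).
rewrite !inE mem_next mem_prev uc (next_cycle c_cycle) //.
by rewrite e_sym (prev_cycle c_cycle) // next_neq_prev.
Qed.

(** The vertices of the cycle induce at least as many edges as vertices, and growing this set to all
    of [G] gives one inequality. For the other, a surplus edge would leave a cycle even after an
    edge of the first cycle is deleted, against uniqueness. *)
Lemma unicyclic_deg_sum (G : simple_graph) :
  unicyclic G -> \sum_(u : G) deg u = #|G|.*2.
Proof.
case=> G_conn [_ [[c [c_ucycle c_size ->]] C_uniq]].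
have e_sym := @adj_sym G; have e_irr := @adj_irr G.
have degE : \sum_(u : G) deg u = inner_deg_sum (@adj G) [set: G].
  rewrite /inner_deg_sum; apply: eq_big => u; rewrite ?inE // => _.
  by apply: eq_card => v; rewrite !inE.
have [c_cycle _] := andP c_ucycle.
have [x xc] : exists x, x \in c.
  by case: (c) c_size => // x ?; exists x; rewrite mem_head.
apply/eqP; rewrite eqn_leq; apply/andP; split; last first.
  rewrite degE; apply: (@inner_deg_sum_grow _ _ [set u in c]) => //.
    by apply/set0Pn; exists x; rewrite inE.
  rewrite -muln2 -sum_nat_const; apply: leq_sum => u; rewrite inE => uc.
  rewrite (leq_trans (cycle_deg_gt1 e_sym c_ucycle c_size uc)) //
    subset_leq_card //.
  by apply/subsetP=> v; rewrite !inE.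
(* Deleting an edge of the unique cycle leaves an acyclic graph. *)
rewrite leqNgt; apply/negP => deg_gt.
set y := next c x.
have exy : adj x y by apply: next_cycle.
have xy : x != y by apply: contraTneq exy => <-; rewrite e_irr.
pose e' : rel G := fun u v => adj u v && ([set u; v] != [set x; y]).
have e'_sym : symmetric e' by move=> u v; rewrite /e' e_sym setUC.
have e'_irr : irreflexive e' by move=> u; rewrite /e' e_irr.
have sum_e' : \sum_(u : G) deg u <= (inner_deg_sum e' [set: G]).+2.
  (* Only the two ends of the deleted edge lose a neighbour, and each loses just one. *)
  have deg_le u : deg u <= #|[set v in [set: G] | e' u v]| + (u \in [set x; y]).
    rewrite /deg -(cardsID [set v | [set u; v] == [set x; y]]) addnC leq_add //.
      by rewrite subset_leq_card //; apply/subsetP=> v; rewrite !inE andbC.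
    have [u_xy | u_xy] := boolP (u \in [set x; y]); last first.
      rewrite leqn0 cards_eq0; apply/eqP/setP=> v; rewrite !inE.
      by apply: contraNF u_xy => /andP[_ /eqP <-]; rewrite set21.
    apply/card_le1_eqP=> v w; rewrite !inE => /andP[uv /eqP eqv]
      /andP[_ /eqP eqw].
    have : v \in [set u; w] by rewrite eqw -eqv set22.
    by rewrite !inE => /orP[/eqP vu|/eqP //]; rewrite vu e_irr in uv.
  have card_xy : \sum_u (u \in [set x; y] : nat) = 2.
    transitivity #|[set x; y]|; last by rewrite cards2 xy.
    by rewrite -sum1_card [RHS]big_mkcond; apply: eq_bigr => u _; case: ifP.
  apply: leq_trans (leq_sum _ (fun u _ => deg_le u)) _.
  rewrite big_split /= card_xy addn2 !ltnS.
  by rewrite /inner_deg_sum [leqRHS](eq_bigl xpredT) // => u; rewrite inE.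
have [c' c'_ucycle c'_size] : exists2 c' : seq G, ucycle e' c' & 2 < size c'.
  apply: (@ucycle_of_inner_deg_sum _ e' [set: G]) => //.
    by apply/set0Pn; exists x; rewrite inE.
  by rewrite cardsT -ltnS (leq_trans deg_gt).
have [c'_cycle c'_uniq] := andP c'_ucycle.
have : [set x; y] \in [set [set u; next c u] | u in c].
  by apply/imsetP; exists x.
rewrite (C_uniq [set [set u; next c' u] | u in c']); last first.
  exists c'; split=> //; rewrite /ucycle c'_uniq andbT.
  by apply: sub_cycle c'_cycle => u v; case/andP.
case/imsetP=> u uc' eq_xy.
by have := next_cycle c'_cycle uc'; rewrite /e' eq_xy eqxx andbF.
Qed.

(** * Extremal sums of a strictly convex function *)

Local Open Scope ring_scope.

Definition strictly_convex (R : realDomainType) (h : nat -> R) :=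
  forall x, h x.+1 - h x < h x.+2 - h x.+1.

(** The [k] increments of [h] starting at [x] are termwise smaller than those starting at [y]. *)
Lemma strictly_convex_shift (R : realDomainType) (h : nat -> R) x y k :
  strictly_convex h -> (x < y)%N -> (0 < k)%N ->
  h (x + k)%N + h y < h x + h (y + k)%N.
Proof.
move=> hc lt_xy; have hstep i j : (i < j)%N -> h i.+1 - h i < h j.+1 - h j.
  by apply: (@homo_ltn _ (fun i => h i.+1 - h i) <%R) => //; exact: lt_trans.
case: k => // k _; elim: k => [|k IHk].
  by rewrite !addn1; have := hstep _ _ lt_xy; lra.
have := hstep (x + k.+1)%N (y + k.+1)%N; rewrite ltn_add2r => /(_ lt_xy).
by rewrite !(addnS _ k.+1); lra.
Qed.

(** Since [h 0 = 0], zero entries do not affect the sums, so a maximizer is determined only up to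
    zeros. *)
Definition positives (s : seq nat) := [seq x <- s | (0 < x)%N].

(* The right-hand side is the value of the greedy filling of the total
   [sumn s] by copies of [m] and one remainder. *)
Lemma convex_sum_capped (R : realDomainType) (h : nat -> R) m s :
  strictly_convex h -> h 0%N = 0 -> (0 < m)%N -> all (fun x => (x <= m)%N) s ->
  let q := (sumn s %/ m)%N in let r := (sumn s %% m)%N in
  \sum_(x <- s) h x <= h m *+ q + h r /\
  (\sum_(x <- s) h x = h m *+ q + h r ->
   perm_eq (positives s) (nseq q m ++ positives [:: r])).
Proof.
move=> hc h0 m_gt0; elim: s => [_ /=|x s IHs /= /andP[le_xm /IHs]].
  by rewrite big_nil div0n mod0n h0 mulr0n addr0.
move: (sumn s) => t /= {IHs}.
rewrite big_cons; move: (\sum_(j <- s) h j) => S [leS eqS].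
have r_lt := ltn_pmod t m_gt0.
have [-> | x_neq0] := eqVneq x 0%N; first by rewrite h0 add0r.
have [-> | x_neqm] := eqVneq x m.
  rewrite divnDl ?dvdnn // divnn m_gt0 modnDl add1n mulrS -addrA.
  by split=> [|/addrI/eqS]; rewrite ?lerD2l // /= perm_cons.
have x_gt0 : (0 < x)%N by rewrite lt0n.
have x_ltm : (x < m)%N by rewrite ltn_neqAle x_neqm.
(* With no remainder so far, [x] itself becomes the remainder. *)
have [r0 | r_neq0] := eqVneq (t %% m)%N 0%N.
  have tE : t = (t %/ m * m)%N by rewrite {1}(divn_eq t m) r0 addn0.
  move: leS eqS; rewrite r0 h0 addr0 cats0 => leS eqS.
  have -> : ((x + t) %/ m = t %/ m)%N.
    by rewrite {1}tE addnC divnMDl // (divn_small x_ltm) addn0.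
  have -> : ((x + t) %% m = x)%N by rewrite {1}tE addnC modnMDl modn_small.
  rewrite x_gt0; split=> [|eqxS]; first by lra.
  have /eqS : S = h m *+ (t %/ m) by lra.
  by rewrite -cat1s perm_catC perm_cat2r.
(* Here [x] and the old remainder both lie strictly between 0 and [m]; combining them gains
   strictly, so equality is excluded. *)
suff lt_xS : h x + S < h m *+ ((x + t) %/ m) + h ((x + t) %% m)%N.
  by split=> [|eq_xS]; [apply: ltW | move: lt_xS; rewrite eq_xS ltxx].
have r_gt0 : (0 < t %% m)%N by rewrite lt0n.
apply: le_lt_trans (_ : h x + (h m *+ (t %/ m) + h (t %% m)%N) < _).
  by rewrite lerD2l.
have [lt_xr | le_mxr] := ltnP (x + t %% m) m.
  have -> : ((x + t) %/ m = t %/ m)%N.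
    by rewrite {1}(divn_eq t m) addnCA divnMDl // (divn_small lt_xr) addn0.
  have -> : ((x + t) %% m = x + t %% m)%N by rewrite -modnDmr modn_small.
  have := strictly_convex_shift hc x_gt0 r_gt0.
  by rewrite h0 !add0n; lra.
have -> : ((x + t) %/ m = (t %/ m).+1)%N.
  rewrite {1}(divn_eq t m) addnCA divnMDl //.
  have lt_m : (x + t %% m - m < m)%N by lia.
  by rewrite -(subnK le_mxr) divnDr // divnn m_gt0 (divn_small lt_m) addn1.
have -> : ((x + t) %% m = x + t %% m - m)%N.
  by rewrite -modnDmr -{1}(subnK le_mxr) modnDr modn_small //; lia.
(* The old remainder gives [m - x] to [x], which becomes a full [m]; what is left of it is the new
   remainder. *)
have := @strictly_convex_shift _ h (x + t %% m - m) x (m - x) hc.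
have -> : (x + t %% m - m + (m - x) = t %% m)%N by lia.
rewrite (subnKC le_xm) mulrS subn_gt0 => /(_ _ x_ltm) lt_h.
by have /lt_h : (x + t %% m - m < x)%N by [lia]; lra.
Qed.

(** A cap of [(sumn s).+1] is positive and exceeds the total, so the greedy filling has no full copy
    and consists of the remainder [sumn s] alone. *)
Lemma convex_sum (R : realDomainType) (h : nat -> R) s :
  strictly_convex h -> h 0%N = 0 ->
  \sum_(x <- s) h x <= h (sumn s) /\
  (\sum_(x <- s) h x = h (sumn s) ->
   perm_eq (positives s) (positives [:: sumn s])).
Proof.
move=> hc h0; have s_le : all (fun x => (x <= (sumn s).+1)%N) s.
  elim: s => //= x s IHs; rewrite (leq_trans (leq_addr _ _) (leqnSn _)) /=.
  by apply: sub_all IHs => y; lia.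
have := convex_sum_capped hc h0 (ltn0Sn _) s_le.
by rewrite /= divn_small // modn_small // mulr0n add0r.
Qed.

Lemma positives_perm s :
  (0 < size (positives s))%N -> exists x s', (0 < x)%N /\ perm_eq s (x :: s').
Proof.
case def_s: (positives s) => [//|x s1] _.
have : x \in positives s by rewrite def_s mem_head.
by rewrite mem_filter => /andP[x_gt0 /perm_to_rem]; exists x, (rem x s).
Qed.

(** One copy of [m] and one further positive [x] are set aside. The other entries, of positive total
    [t], are merged into one; then the pair [x], [t] is spread to [x + t - 1], [1]. *)
Lemma convex_sum_three (R : realDomainType) (h : nat -> R) m s :
  strictly_convex h -> h 0%N = 0 -> (0 < m)%N -> m \in s ->
  (3 <= size (positives s))%N ->
  let z := [:: m; (sumn s - m - 1)%N; 1%N] in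
  \sum_(x <- s) h x <= \sum_(x <- z) h x /\
  (\sum_(x <- s) h x = \sum_(x <- z) h x -> perm_eq (positives s) z).
Proof.
move=> hc h0 m_gt0 /perm_to_rem; move: (rem m s) => s1 s_s1 /=.
rewrite (perm_size (perm_filter _ s_s1)) (perm_sumn s_s1) (perm_big _ s_s1) /=.
rewrite m_gt0 /= addKn ltnS => s1_pos.
have [x [s2 [x_gt0 s1_s2]]] := positives_perm (ltnW s1_pos).
have s_s2 : perm_eq s [:: m, x & s2].
  by rewrite (perm_trans s_s1) // perm_cons.
move: s1_pos.
rewrite (perm_size (perm_filter _ s1_s2)) (perm_sumn s1_s2) /=
  x_gt0 /= ltnS => s2_pos.
have t_gt0 : (0 < sumn s2)%N.
  have [y [s3 [y_gt0 /perm_sumn ->]]] := positives_perm s2_pos.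
  by rewrite /= addn_gt0 y_gt0.
rewrite !big_cons !big_nil (perm_big _ s1_s2) big_cons /= addr0.
have [le2 eq2] := convex_sum s2 hc h0.
have [le_xt eq_xt] : h x + h (sumn s2) <= h (x + sumn s2 - 1)%N + h 1%N /\
  (h x + h (sumn s2) = h (x + sumn s2 - 1)%N + h 1%N ->
   perm_eq [:: x; sumn s2] [:: (x + sumn s2 - 1)%N; 1%N]).
  move: (sumn s2) t_gt0 => t t_gt0.
  have [-> | x_neq1] := eqVneq x 1%N.
    by rewrite addKn [h 1%N + _]addrC; split=> // _;
      rewrite (perm_catC [:: _] [:: _]).
  have [-> | t_neq1] := eqVneq t 1%N; first by rewrite addnK.
  (* When neither [x] nor [t] is 1, moving [t - 1] units from [t] to [x] gains strictly. *)
  have lt_1x : (1 < x)%N by lia.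
  have := @strictly_convex_shift _ h 1 x (t - 1) hc lt_1x.
  rewrite subn_gt0 subnKC // addnBA // => lt_h.
  have /lt_h {}lt_h: (1 < t)%N by lia.
  by split=> [|eqh]; first lra; move: lt_h; rewrite addrC eqh [ltRHS]addrC ltxx.
split=> [|eqs]; first by lra.
have /eq2 p2 : \sum_(x <- s2) h x = h (sumn s2) by lra.
have /eq_xt pxt : h x + h (sumn s2) = h (x + sumn s2 - 1)%N + h 1%N by lra.
rewrite (permPl (perm_filter _ s_s2)) /= m_gt0 x_gt0 perm_cons -(permPr pxt).
by rewrite perm_cons (permPl p2) /= t_gt0.
Qed.

(** * The index as a vertex sum, and the convexity of its summand *)

Lemma SEI_vertex_sum (R : realType) (a : R) (G : simple_graph) :
  SEI a G = \sum_(u : G) (deg u)%:R * a ^+ deg u.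
Proof.
rewrite /SEI (exchange_big_dep xpredT) //=; apply: eq_bigr => u _.
rewrite sumr_const mulr_natl; congr (_ *+ _).
(* The map from [v] to [[set u; v]] is a bijection from the neighbours of [u] to the edges at
   [u]. *)
have -> : deg u = #|(fun v : G => [set u; v]) @: [set v | adj u v]|.
  rewrite card_in_imset // => v w; rewrite !inE => uv _ eq_vw.
  have : v \in [set u; w] by rewrite -eq_vw set22.
  by rewrite !inE => /orP[/eqP vu|/eqP //]; rewrite vu adj_irr in uv.
apply: eq_card => f; rewrite unfold_in; apply/andP/imsetP.
  case=> /imset2P[x y _]; rewrite inE /= => xy -> .
  rewrite !inE => /orP[/eqP-> | /eqP->]; first by exists y; rewrite ?inE.
  by exists x; rewrite ?inE 1?adj_sym // setUC.
case=> v; rewrite inE => uv ->; split; last by rewrite set21.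
by apply/imset2P; exists u v; rewrite ?inE.
Qed.

Lemma connected_deg_gt0 (G : simple_graph) (u : G) :
  connected G -> (1 < #|G|)%N -> (0 < deg u)%N.
Proof.
move=> G_conn; rewrite (cardD1 u) inE ltnS => /card_gt0P[v].
rewrite !inE => /andP[vu _].
have /connectP[[|w p] /= uwp eq_v] := G_conn u v.
  by rewrite eq_v eqxx in vu.
by apply/card_gt0P; exists w; rewrite inE; case/andP: uwp.
Qed.

Lemma unicyclic_three_deg_gt1 (G : simple_graph) :
  unicyclic G -> (3 <= #|[pred u : G | (1 < deg u)%N]|)%N.
Proof.
case=> _ [_ [[c [c_ucycle c_size _]] _]].
apply: leq_trans (c_size) _; have /andP[_ /card_uniqP <-] := c_ucycle.
apply: subset_leq_card; apply/subsetP=> u uc; rewrite inE.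
apply: leq_trans (cycle_deg_gt1 (@adj_sym G) c_ucycle c_size uc) _.
by apply: subset_leq_card; apply/subsetP=> v; rewrite !inE => /andP[].
Qed.

Lemma deg_ltn_card (G : simple_graph) (u : G) : (deg u < #|G|)%N.
Proof.
rewrite -[#|G|]cardsT; apply: proper_card; apply/properP; split.
  exact: subsetT.
by exists u; rewrite ?inE ?adj_irr.
Qed.

(** From e^x > 1 + x at x = 2. It places the range a <= e^-2 below 1/3. *)
Lemma expRN2_lt (R : realType) : 3 * expR (- 2) < 1 :> R.
Proof.
have : 1 + 2 < expR 2 :> R by apply: expR_gt1Dx; rewrite pnatr_eq0.
rewrite expRN => lt_e; have e_gt0 := expR_gt0 (2 : R).
by rewrite ltr_pdivrMr // mul1r; lra.
Qed.

(** With f(x) = x a^x, the function is f(x + 1) - f(1): the argument stands for d_u - 1, and the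
    constant makes the value at 0 vanish. *)
Lemma exdeg_convex (R : realType) (a : R) :
  1 < a \/ 0 < a /\ a <= expR (- 2) ->
  strictly_convex (fun x => x.+1%:R * a ^+ x.+1 - 1%:R * a ^+ 1).
Proof.
move=> ha x.
have a_gt0 : 0 < a by case: ha => [|[]//]; apply: lt_trans.
have ax_gt0 : 0 < a ^+ x.+1 by rewrite exprn_gt0.
rewrite -subr_gt0.
set d := (X in 0 < X).
(* Factored second difference: the last two factors are both negative for a > 1 and both positive
   for 0 < a < 1/3. *)
have -> : d = a ^+ x.+1 * ((1 - a) * (x%:R * (1 - a) + (1 - 3 * a))).
  by rewrite /d !exprS -[x.+3]addn3 -[x.+2]addn2 -[x.+1]addn1 !natrD; ring.
rewrite mulr_gt0 //; have x_ge0 := ler0n R x.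
case: ha => [a_gt1 | [_ a_le]].
  by rewrite nmulr_lgt0; nra.
have := expRN2_lt R => lt3; rewrite mulr_gt0; [by [] | lra | nra].
Qed.

(** * From extremal sums to degree sequences *)

Lemma positives_pad s z :
  perm_eq (positives s) z -> perm_eq s (z ++ nseq (size s - size z) 0%N).
Proof.
move=> s_z.
rewrite perm_sym -(permPr (permEl (perm_filterC (fun x => (0 < x)%N) s)))
  -/(positives s).
rewrite -(perm_size s_z) perm_cat // 1?perm_sym //.
suff -> : nseq (size s - size (positives s)) 0%N
  = [seq x <- s | ~~ (0 < x)%N] by [].
rewrite /positives size_filter -(count_predC (fun x => (0 < x)%N)) addKn
  -size_filter.
symmetry; apply/all_pred1P/allP => x; rewrite mem_filter /= -eqn0Ngt.
by case/andP.
Qed.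

Lemma pairwise_nseq T (r : rel T) k x : r x x -> pairwise r (nseq k x).
Proof. by move=> rxx; elim: k => //= k ->; rewrite all_nseq rxx orbT. Qed.

Lemma geq_trans : transitive geq.
Proof. by move=> x y z /= yx zy; apply: leq_trans yx. Qed.

Lemma degree_seq_eq (G : simple_graph) z :
  sorted geq z -> perm_eq [seq deg u | u : G] z -> degree_seq G = z.
Proof.
move=> z_sorted G_z; apply: (sorted_eq geq_trans) => //.
- by move=> x y; rewrite /= andbC; apply: anti_leq.
- by apply: sort_sorted => x y; exact: leq_total.
- by rewrite /degree_seq perm_sort.
Qed.

(* [z] lists the positive values of d_u - 1 in the extremal degree sequence. *)
Lemma SEI_extremal (R : realType) (a : R) (G : simple_graph) D z :
  unicyclic G -> (1 < #|G|)%N ->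
  zseq #|G| D = map S (z ++ nseq (#|G| - size z) 0%N) ->
  (size z <= #|G|)%N -> sorted geq (zseq #|G| D) ->
  let h x := x.+1%:R * a ^+ x.+1 - 1%:R * a ^+ 1 in
  let s := [seq (deg u).-1 | u : G] in
  (\sum_(x <- s) h x <= \sum_(x <- z) h x /\
   (\sum_(x <- s) h x = \sum_(x <- z) h x -> perm_eq (positives s) z)) ->
  let B := \sum_(x <- zseq #|G| D) x%:R * a ^+ x in
  SEI a G <= B /\ (SEI a G = B <-> in_K #|G| D G).
Proof.
move=> G_uni G_gt1 def_z z_le z_sorted h s [le_sz eq_sz] B.
have size_s : size s = #|G| by rewrite size_map -cardE.
have degS : [seq deg u | u : G] = map S s.
  rewrite -map_comp; apply: eq_map => u /=.
  by rewrite prednK // connected_deg_gt0 //; case: G_uni.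
(* Undoing the normalization costs f(1) = a per entry. Both lists have [#|G|] entries, so the same
   constant appears on both sides and cancels. *)
have sumS t : \sum_(x <- map S t) x%:R * a ^+ x
    = \sum_(x <- t) h x + (1%:R * a ^+ 1) *+ size t.
  elim: t => [|x t IHt] /=; first by rewrite !big_nil addr0.
  by rewrite !big_cons IHt (mulrS _ (size t)) addrACA /h subrK.
have SEI_s : SEI a G = \sum_(x <- s) h x + (1%:R * a ^+ 1) *+ #|G|.
  rewrite -size_s -sumS -degS big_map SEI_vertex_sum big_enum //.
have B_z : B = \sum_(x <- z) h x + (1%:R * a ^+ 1) *+ #|G|.
  rewrite /B def_z sumS size_cat size_nseq subnKC // big_cat /=.
  by rewrite [X in _ + X + _]big_nseq iter_addr /h subrr mul0rn !addr0.
rewrite SEI_s B_z lerD2r; split=> //; split.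
  (* Equality fixes the positive values of d_u - 1; the number of vertices then fixes the number of
     zeros. *)
  move/addIr/eq_sz/positives_pad; rewrite size_s => s_z; split=> //.
  by apply: degree_seq_eq => //; rewrite def_z degS perm_map.
case=> _ _ deg_z; rewrite -SEI_s -B_z /B -deg_z.
by rewrite (perm_big _ (permEl (perm_sort _ _))) big_map
  SEI_vertex_sum big_enum.
Qed.

(** * The two cases of the bound *)

Theorem theorem4p18 (R : realType) (a : R) (G : simple_graph) (n D q : nat)
    (hG : unicyclic G) (hn : #|G| = n) (hn4 : (4 <= n)%N)
    (hD : max_degree G = D) (hD3 : (3 <= D)%N)
    (hq : q = (n %/ (D - 1))%N)
    (ha : 1 < a \/ (0 < a /\ a <= expR (- 2))) :
  ((q = 1%N \/ n = (2 * D - 2)%N) ->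
     let B := D%:R * a ^+ D + (n - D + 1)%:R * a ^+ (n - D + 1)
              + 2 * a ^+ 2 + (n - 3)%:R * a in
     SEI a G <= B /\ (SEI a G = B <-> in_K n D G))
  /\
  (((1 < q)%N /\ n <> (2 * D - 2)%N) ->
     let B := q%:R * D%:R * a ^+ D
              + (n - q * (D - 1) + 1)%:R * a ^+ (n - q * (D - 1) + 1)
              + (n - q - 1)%:R * a in
     SEI a G <= B /\ (SEI a G = B <-> in_K n D G)).
Proof.
have [G_conn _] := hG.
have hc := exdeg_convex ha.
pose h (x : nat) := x.+1%:R * a ^+ x.+1 - 1%:R * a ^+ 1.
pose s := [seq (deg u).-1 | u : G].
have h0 : h 0%N = 0 by rewrite /h subrr.
have G_gt1 : (1 < #|G|)%N by lia.
have sum_s : sumn s = n.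
  (* Adding 1 per vertex turns d_u - 1 into d_u, and the degrees sum to 2n. *)
  rewrite sumnE big_map big_enum /=; apply: (@addIn #|G|).
  rewrite -{1}[#|G|]sum1_card -big_split /= hn addnn -hn -unicyclic_deg_sum //.
  by apply: eq_bigr => u _; rewrite addn1 prednK ?connected_deg_gt0.
have s_pos : (3 <= size (positives s))%N.
  rewrite size_filter count_map.
  apply: leq_trans (unicyclic_three_deg_gt1 hG) _.
  rewrite cardE {1}/enum_mem size_filter -enumT.
  apply: eq_leq; apply: eq_count => u.
  by rewrite /= inE; case: (deg u).
have deg_le (u : G) : (deg u <= D)%N by rewrite -hD; exact: (leq_bigmax u).
have [u0 deg_u0] : exists u0 : G, deg u0 = D.
  by have [u0 max_u0] := bigop.eq_bigmax (@deg G) (ltnW G_gt1);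
    exists u0; rewrite -hD -max_u0.
have D_lt : (D < n)%N by rewrite -deg_u0 -hn deg_ltn_card.
have mem_s : (D - 1)%N \in s.
  by apply/mapP; exists u0; rewrite ?mem_enum // deg_u0 subn1.
have m_gt0 : (0 < D - 1)%N by lia.
have le_s : all (fun x => (x <= D - 1)%N) s.
  by apply/allP=> _ /mapP[u _ ->]; have := deg_le u; lia.
split=> [case1 B | [q_gt1 n_neq] B].
  (* This gives n - D + 1 < D, so [zseq n D] is non-increasing. *)
  have n_le : (n <= 2 * (D - 1))%N.
    case: case1 => [q1|]; last by lia.
    have := ltn_ceil n m_gt0; rewrite -hq q1; lia.
  have n_ge : (D - 1 < n)%N by lia.
  have zE : zseq n D = [:: D, n - D + 1, 2 & nseq (n - 3) 1]%N.
    by rewrite /zseq -hq; case: case1 => ->; rewrite eqxx ?orbT.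
  have -> : B = \sum_(x <- zseq n D) x%:R * a ^+ x.
    rewrite zE !big_cons big_nseq iter_addr addr0 expr1 mul1r /B.
    by rewrite [(n - 3)%:R * a]mulr_natl !addrA.
  rewrite -hn.
  apply: (@SEI_extremal _ _ _ _ [:: D - 1; n - (D - 1) - 1; 1]%N) => //.
  - rewrite hn zE /= map_nseq; congr [:: _, _ , _ & _]; lia.
  - by rewrite hn /=; lia.
  - rewrite hn zE sorted_pairwise; last exact: geq_trans.
    rewrite /= !all_nseq pairwise_nseq //=; lia.
  - by rewrite -sum_s; apply: convex_sum_three.
have q_ge : (q * (D - 1) <= n)%N by rewrite hq leq_trunc_div.
(* As D - 1 >= 2, q < q (D - 1) <= n; hence [n - q - 1] is not truncated. *)
have q_lt : (q < n)%N.
  by apply: leq_trans q_ge; rewrite -{1}[q]muln1 ltn_pmul2l; lia.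
have rE : (n %% (D - 1) = n - q * (D - 1))%N.
  by have := divn_eq n (D - 1); rewrite -hq; lia.
have zE :
  zseq n D = (nseq q D ++ (n - q * (D - 1) + 1) :: nseq (n - q - 1) 1)%N.
  by rewrite /zseq -hq; case: eqP q_gt1 => [->|_] // _; case: eqP.
have -> : B = \sum_(x <- zseq n D) x%:R * a ^+ x.
  rewrite zE big_cat big_cons !big_nseq !iter_addr !addr0 expr1 mul1r.
  by rewrite /= /B -mulrA !mulr_natl addrA.
rewrite -hn.
apply: (@SEI_extremal _ _ _ _
  (nseq q (D - 1) ++ positives [:: n %% (D - 1)])%N) => //.
- rewrite hn zE /= !map_cat !map_nseq size_cat size_nseq -catA rE.
  congr (nseq _ _ ++ _); first lia.
  (* If the remainder is 0, the middle entry of [zseq] equals 1 and comes from one extra padding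
     zero. *)
  case: posnP => [->|_] /=; last by rewrite addn1 subnDA.
  by have -> : (n - (q + 0) = (n - q - 1).+1)%N by lia.
- rewrite hn size_cat size_nseq /=; case: ifP => /= _; lia.
- rewrite hn zE sorted_pairwise; last exact: geq_trans.
  rewrite pairwise_cat /= all_nseq !pairwise_nseq //=.
  have r_lt : (n - q * (D - 1) + 1 <= D)%N.
    by have := ltn_pmod n m_gt0; rewrite rE; lia.
  rewrite addn1 orbT !andbT; apply/allrelP => x y /nseqP[-> _].
  by rewrite inE -addn1 => /predU1P[->|/nseqP[-> _]] //=; lia.
have := convex_sum_capped hc h0 m_gt0 le_s; rewrite /= sum_s -hq.
rewrite big_cat big_nseq iter_addr addr0 /=.
suff -> : \sum_(x <- positives [:: n %% (D - 1)]%N) h x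
  = h (n %% (D - 1))%N by [].
by rewrite /=; case: posnP => [->|_]; rewrite ?big_nil ?h0 // big_seq1.
Qed.
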